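(* Let $G$ be a finitely generated group, and let $\Gamma=A\times_{\sigma,\chi}B$ be a finite group which is an extension of a group $B$ by an abelian group $A$, with monodromy $\sigma\colon B\to\mathrm{Aut}(A)$ and normalized $2$-cocycle $\chi\colon B\times B\to A$. Then the number of homomorphisms from $G$ to $\Gamma$ is $$|\mathrm{Hom}(G,A\times_{\sigma,\chi}B)|=\sum_{\rho\in\mathrm{Hom}(G,B)}\epsilon_\chi(\rho)\cdot|Z^1_{\sigma\rho}(G,A)|.$$
   Context: Abelian groups are written additively. For an extension $1\to A\xrightarrow{i}\Gamma\xrightarrow{\pi}B\to1$ with $A$ abelian and a set section $s\colon B\to\Gamma$ of $\pi$ with $s(1)=1$, the monodromy $\sigma$ is defined by $i(\sigma_b(a))=s(b)i(a)s(b)^{-1}$, and the normalized $2$-cocycle $\chi$ by $i(\chi(b,b'))=s(b)s(b')s(bb')^{-1}$; one writes $\Gamma=A\times_{\sigma,\chi}B$, whose elements are pairs $(a,b)$ with multiplication $(a_1,b_1)(a_2,b_2)=(a_1+\sigma_{b_1}(a_2)+\chi(b_1,b_2),\,b_1b_2)$. For $\rho\colon G\to B$, $A$ is a $G$-module via $\sigma\rho$, and $Z^1_{\sigma\rho}(G,A)$ is the group of $1$-cocycles, i.e. maps $f\colon G\to A$ with $f(gh)=f(g)+\sigma_{\rho(g)}(f(h))$ for all $g,h\in G$. Define $\epsilon_\chi(\rho)=1$ if there exists a map $f\colon G\to A$ with $f(gh)=f(g)+\sigma_{\rho(g)}(f(h))+\chi(\rho(g),\rho(h))$ for all $g,h\in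 G$ (equivalently, $\delta^1 f=-\rho^*\chi$), and $\epsilon_\chi(\rho)=0$ otherwise. *)

(* Defs.v *)
From HB Require Import structures.
From mathcomp Require Import all_boot all_order all_algebra all_fingroup.
From mathcomp Require Import finmap.
From mathcomp Require Import boolp classical_sets functions cardinality fsbigop.

Set Implicit Arguments.
Unset Strict Implicit.
Unset Printing Implicit Defensive.

Import GRing.Theory.

Local Open Scope classical_set_scope.
Local Open Scope group_scope.

Definition finitely_generated (G : groupType) : Prop :=
  exists gens : seq G, forall S : {pred G},
    group_closed S -> {subset gens <= S} -> forall x, x \in S.

Definition gHom (G H : groupType) : set (G -> H) :=
  [set f | {morph f : x y / x * y}].
Arguments gHom : clear implicits.

Definition Z1 (G B : groupType) (A : zmodType) (sigma : B -> A -> A)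
    (rho : G -> B) : set (G -> A) :=
  [set f | forall g h, f (g * h) = (f g + sigma (rho g) (f h))%R].

Definition epsilon (G B : groupType) (A : zmodType) (sigma : B -> A -> A)
    (chi : B -> B -> A) (rho : G -> B) : nat :=
  `[< exists f : G -> A, forall g h,
      f (g * h) = (f g + sigma (rho g) (f h) + chi (rho g) (rho h))%R >].

(* [fset_set X] is empty when [X] is infinite; [finite_gHom] and [finite_Z1]
   below show that this convention plays no role for finitely generated [G]. *)
Definition ncard (T : choiceType) (X : set T) : nat := #|` fset_set X|.

(* Extensions 1 -> A -> Gamma -> B -> 1 with a normalized set section;
   surjectivity of [ext_proj] is a consequence of [ext_sectK]. *)
Record extension (A : zmodType) (B Gamma : groupType) := Extension {
  ext_in : A -> Gamma;
  ext_proj : Gamma -> B;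
  ext_sect : B -> Gamma;
  ext_inD : forall a a', ext_in (a + a')%R = ext_in a * ext_in a';
  ext_in_inj : injective ext_in;
  ext_projM : {morph ext_proj : x y / x * y};
  ext_exact : forall x, ext_proj x = 1 <-> exists a, ext_in a = x;
  ext_sectK : cancel ext_sect ext_proj;
  ext_sect1 : ext_sect 1 = 1
}.

Section Extension.
Variables (A : zmodType) (B Gamma : groupType) (E : extension A B Gamma).

Local Notation i := (ext_in E).
Local Notation pr := (ext_proj E).
Local Notation s := (ext_sect E).

(* The preimage under the injection [i]; the default 0 is never used, see
   [ext_in_monodromy] and [ext_in_cocycle]. *)
Definition ext_out (x : Gamma) : A := xget 0%R [set a | i a = x].

Definition monodromy (b : B) (a : A) : A := ext_out (s b * i a * (s b)^-1).

Definition cocycle (b b' : B) : A := ext_out (s b * s b' * (s (b * b'))^-1).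

Lemma ext_outK x : pr x = 1 -> i (ext_out x) = x.
Proof. by move/ext_exact; apply: (@xgetPex _ 0%R [set a | i a = x]). Qed.

Lemma ext_in0 : i 0%R = 1.
Proof. by apply: (mulgI (i 0%R)); rewrite -ext_inD addr0 mulg1. Qed.

Lemma ext_inN a : i (- a)%R = (i a)^-1.
Proof. by apply: (mulgI (i a)); rewrite -ext_inD subrr ext_in0 mulgV. Qed.

Lemma ext_proj_in a : pr (i a) = 1.
Proof. by apply/ext_exact; exists a. Qed.

Lemma ext_proj1 : pr 1 = 1.
Proof. by rewrite -ext_in0 ext_proj_in. Qed.

Lemma ext_projV x : pr x^-1 = (pr x)^-1.
Proof. by apply: (mulgI (pr x)); rewrite -ext_projM !mulgV ext_proj1. Qed.

Lemma ext_in_monodromy b a : i (monodromy b a) = s b * i a * (s b)^-1.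
Proof.
by apply: ext_outK; rewrite !ext_projM ext_projV ext_proj_in mulg1 mulgV.
Qed.

Lemma ext_in_cocycle b b' : i (cocycle b b') = s b * s b' * (s (b * b'))^-1.
Proof.
by apply: ext_outK; rewrite !ext_projM ext_projV !ext_sectK mulgV.
Qed.

End Extension.

(* The group A x_{sigma,chi} B attached to an extension. *)
Definition tprod (A : zmodType) (B Gamma : groupType)
  (E : extension A B Gamma) : Type := (A * B)%type.

HB.instance Definition _ (A : zmodType) (B Gamma : groupType)
  (E : extension A B Gamma) :=
  Choice.copy (tprod E) (A * B)%type.

Section TwistedProduct.
Variables (A : zmodType) (B Gamma : groupType) (E : extension A B Gamma).

Local Notation i := (ext_in E).
Local Notation pr := (ext_proj E).
Local Notation s := (ext_sect E).

Definition tprod_mul (x y : tprod E) : tprod E :=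
  ((x.1 + monodromy E x.2 y.1 + cocycle E x.2 y.2)%R, x.2 * y.2).

Definition tprod_one : tprod E := (0%R, 1).

Definition tprod_inv (x : tprod E) : tprod E :=
  ((- (monodromy E x.2^-1 x.1 + cocycle E x.2^-1 x.2))%R, x.2^-1).

Definition of_tprod (x : tprod E) : Gamma := i x.1 * s x.2.

Lemma of_tprod_inj : injective of_tprod.
Proof.
move=> [a b] [a' b'] e; have e2 : b = b'.
  by move: (congr1 pr e); rewrite !ext_projM !ext_proj_in !mul1g !ext_sectK.
by move: e; rewrite /of_tprod /= e2 => /mulIg /ext_in_inj ->.
Qed.

Lemma of_tprod_mul : {morph of_tprod : x y / tprod_mul x y >-> x * y}.
Proof.
move=> [a b] [a' b'].
rewrite /of_tprod /= !ext_inD ext_in_monodromy ext_in_cocycle.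
by rewrite !mulgA !mulgVK.
Qed.

Lemma of_tprod_one : of_tprod tprod_one = 1.
Proof. by rewrite /of_tprod /= ext_in0 ext_sect1 mulg1. Qed.

Lemma tprod_mulVg : left_inverse tprod_one tprod_inv tprod_mul.
Proof.
by move=> [a b]; rewrite /tprod_mul /= -addrA addNr mulVg.
Qed.

Lemma of_tprod_inv x : of_tprod (tprod_inv x) = (of_tprod x)^-1.
Proof.
by apply: (mulIg (of_tprod x)); rewrite -of_tprod_mul tprod_mulVg of_tprod_one
  mulVg.
Qed.

Lemma tprod_mulA : associative tprod_mul.
Proof. by move=> x y z; apply: of_tprod_inj; rewrite !of_tprod_mul mulgA. Qed.

Lemma tprod_mul1g : left_id tprod_one tprod_mul.
Proof.
by move=> x; apply: of_tprod_inj; rewrite of_tprod_mul of_tprod_one mul1g.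
Qed.

Lemma tprod_mulg1 : right_id tprod_one tprod_mul.
Proof.
by move=> x; apply: of_tprod_inj; rewrite of_tprod_mul of_tprod_one mulg1.
Qed.

Lemma tprod_mulgV : right_inverse tprod_one tprod_inv tprod_mul.
Proof.
by move=> x; apply: of_tprod_inj;
  rewrite of_tprod_mul of_tprod_inv of_tprod_one mulgV.
Qed.

HB.instance Definition _ := isGroup.Build (tprod E)
  tprod_mulA tprod_mul1g tprod_mulg1 tprod_mulVg tprod_mulgV.

Lemma of_tprodM : {morph of_tprod : x y / x * y}.
Proof. exact: of_tprod_mul. Qed.

Lemma of_tprod_bij : bijective of_tprod.
Proof.
pose q (x : Gamma) : tprod E := (ext_out E (x * (s (pr x))^-1), pr x).
have qK : cancel q of_tprod.
  move=> x; rewrite /of_tprod /= ext_outK ?mulgVK //.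
  by rewrite ext_projM ext_projV ext_sectK mulgV.
by exists q => // x; apply: of_tprod_inj; rewrite qK.
Qed.

End TwistedProduct.

Lemma finite_determined (T U : Type) (X : set (T -> U)) (gens : seq T) :
  finite_set [set: U] ->
  (forall f g, X f -> X g -> map f gens = map g gens -> f = g) ->
  finite_set X.
Proof.
move=> finU detX.
have fin_seq n : finite_set [set r : seq U | size r = n].
  elim: n => [|n IHn].
    apply: (@sub_finite_set _ _ [set [::]]); last exact: finite_set1.
    by move=> r /size0nil.
  apply: (@sub_finite_set _ _
    [set u :: r | u in [set: U] & r in [set r : seq U | size r = n]]).
    by case=> [|u r] //= [rn]; exists u => //; exists r.
  exact: finite_image2.
have fin_im : finite_set [set map f gens | f in X].
  apply: sub_finite_set (fin_seq (size gens)) => _ [f _ <-] /=.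
  by rewrite size_map.
apply: card_le_finite fin_im.
have : set_inj X (fun f => map f gens).
  by move=> f g /set_mem Xf /set_mem Xg; exact: detX.
by move/inj_card_eq => /card_eqPle[].
Qed.

Section Finiteness.
Variables (G : groupType) (Gfg : finitely_generated G).

Lemma finite_gHom (H : groupType) :
  finite_set [set: H] -> finite_set (gHom G H).
Proof.
move=> finH; have [gens genP] := Gfg.
apply: (finite_determined (gens := gens)) finH _ => f g fM gM efg.
have h1 (k : G -> H) : gHom G H k -> k 1 = 1.
  by move=> kM; apply: (mulgI (k 1)); rewrite -kM !mulg1.
have hV (k : G -> H) x : gHom G H k -> k x^-1 = (k x)^-1.
  by move=> kM; apply: (mulIg (k x)); rewrite -kM !mulVg h1.
pose S : {pred G} := [pred x | `[< f x = g x >]].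
apply: funext => x; suff: x \in S by move/asboolP.
apply: genP => [|y /(nthP 1)[n nlt <-]].
  split=> [|y z /asboolP yS /asboolP zS]; apply/asboolP; first by rewrite !h1.
  by rewrite fM gM !hV // yS zS.
apply/asboolP; have := congr1 (fun r => nth 1 r n) efg.
by rewrite !(nth_map 1).
Qed.

Lemma finite_Z1 (B : groupType) (A : zmodType) (sigma : B -> A -> A)
    (rho : G -> B) :
  finite_set [set: A] -> (forall b, injective (sigma b)) ->
  finite_set (Z1 sigma rho).
Proof.
move=> finA sigI; have [gens genP] := Gfg.
apply: (finite_determined (gens := gens)) finA _ => f g fM gM efg.
have cV (y : G) : f 1 = g 1 -> f y = g y -> f y^-1 = g y^-1.
  move=> e1 ey; apply: (sigI (rho y)); apply: (addrI (f y)).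
  by rewrite -fM {1}ey -gM !mulgV.
pose S : {pred G} := [pred x | `[< f x = g x >]].
have k0 (k : G -> A) : Z1 sigma rho k -> sigma (rho 1) (k 1) = 0%R.
  by move=> kM; apply: (addrI (k 1%g)); rewrite -kM mulg1 addr0.
have e1 : f 1 = g 1 by apply: (sigI (rho 1)); rewrite !k0.
apply: funext => x; suff: x \in S by move/asboolP.
apply: genP => [|y /(nthP 1)[n nlt <-]].
  split=> [|y z /asboolP yS /asboolP zS]; apply/asboolP => //.
  by rewrite fM gM yS cV.
apply/asboolP; have := congr1 (fun r => nth (f 1) r n) efg.
by rewrite !(nth_map 1).
Qed.

End Finiteness.

(* Main.v *)
Require Import Defs.
From HB Require Import structures.
From mathcomp Require Import all_boot all_order all_algebra all_fingroup.
From mathcomp Require Import finmap.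
From mathcomp Require Import boolp classical_sets functions cardinality fsbigop.

(** Compose a homomorphism from G to the twisted product with the projection
    to B: this sorts the homomorphisms by the homomorphism rho from G to B that
    they lift ([ncard_fibres]). A lift of rho is a map g |-> (f g, rho g), and
    the multiplication rule of the twisted product turns multiplicativity into
    the equation f (gh) = f g + sigma_(rho g) (f h) + chi (rho g, rho h)
    ([gHom_tprod_fibre]). This equation is affine in f, with Z^1 as the
    solution set of its homogeneous part; so either there is no solution, and
    epsilon is 0, or translation by one solution is a bijection from Z^1 onto
    the set of all solutions ([ncard_twisted_Z1]).

    The group Gamma itself is isomorphic to the twisted product, and composition
    with the isomorphism identifies the two sets of homomorphisms
    ([gHom_tprod_image]). All these sets are finite since G is finitely
    generated and Gamma, hence also A and B, is finite. *)

Set Implicit Arguments.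
Unset Strict Implicit.
Unset Printing Implicit Defensive.

Import GRing.Theory.

Local Open Scope classical_set_scope.
Local Open Scope group_scope.

(** * Counting finite sets *)

Lemma ncard_sum1 (T : choiceType) (X : set T) :
  finite_set X -> ncard X = (\big[addn/0]_(x \in X) 1)%N.
Proof. by move=> finX; rewrite fsbig_finite // /ncard card_fset_sum1. Qed.

Lemma ncard_image (T U : choiceType) (f : T -> U) (X : set T) :
  finite_set X -> {in X &, injective f} -> ncard (f @` X) = ncard X.
Proof.
move=> finX injf; rewrite /ncard fset_set_image // card_in_imfset //.
by move=> x y; rewrite !in_fset_set //; apply: injf.
Qed.

(** Count the pairs (x, h x), first by x and then by the value h x. *)
Lemma ncard_fibres (T U : choiceType) (h : T -> U) (X : set T) (Y : set U) :
  finite_set X -> finite_set Y -> (forall x, X x -> Y (h x)) ->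
  ncard X = (\big[addn/0]_(y \in Y) ncard (X `&` [set x | h x = y]))%N.
Proof.
move=> finX finY hXY; rewrite ncard_sum1 //.
transitivity
  (\big[addn/0]_(x \in X) \big[addn/0]_(y \in Y) (if h x == y then 1 else 0))%N.
  apply: eq_fsbigr => x /set_mem Xx.
  rewrite fsbig_finite // -big_mkcond /= big_fset_condE /= -card_fset_sum1.
  rewrite (_ : [fset _ | _ in _ & _]%fset = [fset h x]%fset) ?cardfs1 //.
  apply/fsetP => y; rewrite !inE /= in_fset_set // eq_sym andbC.
  by case: eqP => //= ->; rewrite mem_set //; apply: hXY.
rewrite exchange_fsbig //; apply: eq_fsbigr => y _.
rewrite ncard_sum1; last exact: finite_setIl.
rewrite fsbig_mkcondr; apply: eq_fsbigr => x _.
by congr (if _ then _ else _); apply/eqP/idP => [/mem_set|/set_mem].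
Qed.

(** * Twisted cocycles *)

(** The maps f with delta^1 f = - rho^* chi. *)
Definition twisted_Z1 (G B : groupType) (A : zmodType) (sigma : B -> A -> A)
    (chi : B -> B -> A) (rho : G -> B) : set (G -> A) :=
  [set f | forall g h,
     f (g * h) = (f g + sigma (rho g) (f h) + chi (rho g) (rho h))%R].

Section TwistedCocycles.
Variables (G B : groupType) (A : zmodType) (sigma : B -> A -> A).
Variables (chi : B -> B -> A) (rho : G -> B).
Hypothesis sigmaD : forall b, {morph sigma b : x y / (x + y)%R}.

(** The difference of two solutions of an affine equation solves the
    homogeneous one. *)
Lemma twisted_Z1_translate (f0 : G -> A) : twisted_Z1 sigma chi rho f0 ->
  twisted_Z1 sigma chi rho = (fun z g => (f0 g + z g)%R) @` Z1 sigma rho.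
Proof.
move=> f0P; apply/seteqP; split=> [f fP|_ [z zP <-] g h]; last first.
  by rewrite f0P zP sigmaD addrAC (addrACA (f0 g)).
exists (fun g => f g - f0 g)%R; last by apply: funext => g; rewrite addrC subrK.
move=> g h; have := sigmaD (rho g) (f h - f0 h)%R (f0 h); rewrite subrK => e.
apply: (addIr (f0 (g * h))); rewrite subrK fP f0P e !addrA.
congr (_ + _)%R; rewrite -addrA -[in RHS]addrA.
by rewrite [RHS]addrACA subrK.
Qed.

Lemma finite_twisted_Z1 :
  finite_set (Z1 sigma rho) -> finite_set (twisted_Z1 sigma chi rho).
Proof.
move=> finZ; have [->//|/set0P[f0 f0P]] := eqVneq (twisted_Z1 sigma chi rho) set0.
by rewrite (twisted_Z1_translate f0P); apply: finite_image.
Qed.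

Lemma ncard_twisted_Z1 : finite_set (Z1 sigma rho) ->
  ncard (twisted_Z1 sigma chi rho)
    = (epsilon sigma chi rho * ncard (Z1 sigma rho))%N.
Proof.
move=> finZ; rewrite /epsilon.
case: asboolP => [[f0 f0P]|no_f].
  rewrite mul1n (twisted_Z1_translate f0P) ncard_image // => z z' _ _ e.
  by apply: funext => g; apply: (addrI (f0 g)); apply: (congr1 (@^~ g) e).
rewrite mul0n /ncard (_ : twisted_Z1 _ _ _ = set0) ?fset_set0 ?cardfs0 //.
by rewrite -subset0 => f fP; apply: no_f; exists f.
Qed.

End TwistedCocycles.

(** * Homomorphisms to the twisted product *)

Section TwistedProduct.
Variables (A : zmodType) (B Gamma : groupType) (E : extension A B Gamma).

(** Conjugation by the section is an automorphism of the copy of A in Gamma. *)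
Lemma monodromyD b : {morph monodromy E b : a a' / (a + a')%R}.
Proof.
move=> a a'; apply: (@ext_in_inj _ _ _ E).
by rewrite ext_inD !ext_in_monodromy ext_inD !mulgA mulgVK.
Qed.

Lemma monodromy_inj b : injective (monodromy E b).
Proof.
move=> a a' /(congr1 (ext_in E)); rewrite !ext_in_monodromy.
by move=> /mulIg /mulgI /ext_in_inj.
Qed.

Lemma finite_kernel : finite_set [set: Gamma] -> finite_set [set: A].
Proof.
move=> finGamma; apply: card_le_finite finGamma.
apply: card_le_trans (card_leT (range (ext_in E))).
have /inj_card_eq/card_eqPle[] // : {in [set: A] &, injective (ext_in E)}.
by move=> a a' _ _; apply: ext_in_inj.
Qed.

Lemma finite_quotient : finite_set [set: Gamma] -> finite_set [set: B].
Proof.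
move=> /(finite_image (ext_proj E)); congr finite_set.
by apply/seteqP; split=> // b _; exists (ext_sect E b) => //; apply: ext_sectK.
Qed.

Variable G : groupType.

Lemma gHom_tprod_proj (phi : G -> tprod E) :
  gHom G (tprod E) phi -> gHom G B (fun g => (phi g).2).
Proof. by move=> phiM g h; rewrite phiM. Qed.

(** For a fixed homomorphism rho, a map g |-> (f g, rho g) is determined by f,
    and only the A-component of multiplicativity is a condition on f: it is
    the twisted cocycle equation. *)
Lemma gHom_tprod_fibre (rho : G -> B) : gHom G B rho ->
  gHom G (tprod E) `&` [set phi | (fun g => (phi g).2) = rho]
  = (fun f g => (f g, rho g) : tprod E)
      @` twisted_Z1 (monodromy E) (cocycle E) rho.
Proof.
move=> rhoM; apply/seteqP; split=> [phi [phiM /= <-]|_ [f fP <-]].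
  exists (fun g => (phi g).1); first by move=> g h; rewrite phiM.
  by apply: funext => g; case: (phi g).
by split=> // g h; rewrite fP rhoM.
Qed.

(** The inverse of the isomorphism is multiplicative as well, so every
    homomorphism to Gamma factors through the twisted product. *)
Lemma gHom_tprod_image :
  (fun phi => @of_tprod _ _ _ E \o phi) @` gHom G (tprod E) = gHom G Gamma.
Proof.
have [q ofK qK] := of_tprod_bij E.
apply/seteqP; split=> [_ [phi phiM <-] g h /=|psi psiM].
  by rewrite phiM of_tprodM.
exists (q \o psi); last by apply: funext => g; apply: qK.
move=> g h; apply: (@of_tprod_inj _ _ _ E).
by rewrite of_tprodM /= !qK psiM.
Qed.

End TwistedProduct.

Theorem proposition3p2 (G : groupType) (A : zmodType) (B : groupType)
    (Gamma : finGroupType) (E : extension A B Gamma) :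
  finitely_generated G ->
  ncard (gHom G Gamma) = ncard (gHom G (tprod E)) /\
  ncard (gHom G (tprod E)) =
    (\big[addn/0]_(rho \in gHom G B)
       (epsilon (monodromy E) (cocycle E) rho *
        ncard (Z1 (monodromy E) rho)))%N.
Proof.
move=> Gfg; have finGamma : finite_set [set: Gamma] by exact: finite_finset.
have finA := finite_kernel E finGamma; have finB := finite_quotient E finGamma.
have finTP : finite_set [set: tprod E].
  by have := finite_setX finA finB; rewrite setXTT.
have finHom := finite_gHom Gfg finTP.
split.
  rewrite -(gHom_tprod_image E G) ncard_image // => phi psi _ _ e.
  apply: funext => g; apply: (@of_tprod_inj _ _ _ E).
  exact: (congr1 (@^~ g) e).
rewrite (ncard_fibres finHom (finite_gHom Gfg finB) (@gHom_tprod_proj _ _ _ E G)).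
apply: eq_fsbigr => rho /set_mem rhoM.
have finZ : finite_set (Z1 (monodromy E) rho).
  by apply: finite_Z1 => // b; apply: monodromy_inj.
rewrite -ncard_twisted_Z1 //; last exact: monodromyD.
rewrite gHom_tprod_fibre // ncard_image //.
  by apply: finite_twisted_Z1 => //; apply: monodromyD.
by move=> f f' _ _ e; apply: funext => g; case: (congr1 (@^~ g) e).
Qed.
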